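(* Let $p$ be an odd prime and let $S\subset\mathbb F_p^4$ be either of the sets $$\Gamma_0^3=\{(\boldsymbol\xi,\tau,\sigma)\in\mathbb F_p^2\times\mathbb F_p\times\mathbb F_p:\tau\sigma=\boldsymbol\xi\cdot\boldsymbol\xi\},\qquad \Upsilon_0^3=\{(\boldsymbol\xi,\tau,\sigma)\in\mathbb F_p^2\times\mathbb F_p\times\mathbb F_p:\tau^2+\sigma^2=\boldsymbol\xi\cdot\boldsymbol\xi\},$$ equipped with its normalized surface measure $\nu$. Then (nonzero) constant functions on $S$ are not critical points for the $L^2(S,\mathrm d\nu)\to L^4(\mathbb F_p^4,\mathrm d\boldsymbol x)$ extension inequality from $S$.
   Context: $\mathbb F_p$ is the field with $p$ elements and $e:\mathbb F_p\to\mathbb S^1\subset\mathbb C$ is a fixed nontrivial additive character. For $\boldsymbol x,\boldsymbol\xi\in\mathbb F_p^d$, $\boldsymbol x\cdot\boldsymbol\xi=\sum_i x_i\xi_i$. $\nu$ is the uniform probability measure on $S$, and for $f:S\to\mathbb C$, $(f\nu)^\vee(\boldsymbol x)=\frac1{|S|}\sum_{\boldsymbol\xi\in S}f(\boldsymbol\xi)e(\boldsymbol x\cdot\boldsymbol\xi)$ for $\boldsymbol x\in\mathbb F_p^4$. Being a critical point for the $L^2(S,\mathrm d\nu)\to L^4(\mathbb F_p^4,\mathrm d\boldsymbol x)$ extension inequality means being a critical point (vanishing differential, in the sense of real differentiability on the finite-dimensional space of functions $S\to\mathbb C$) of the functional $$f\mapsto\frac{\|(f\nu)^\vee\|_{L^4(\mathbb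 F_p^4,\mathrm d\boldsymbol x)}^4}{\|f\|_{L^2(S,\mathrm d\nu)}^4}=\frac{\sum_{\boldsymbol x\in\mathbb F_p^4}|(f\nu)^\vee(\boldsymbol x)|^4}{\left(\frac1{|S|}\sum_{\boldsymbol\xi\in S}|f(\boldsymbol\xi)|^2\right)^2}$$ defined on functions $f:S\to\mathbb C$ that are not identically zero. *)

(* Defs.v *)
From HB Require Import structures.
From mathcomp Require Import all_boot all_order all_algebra.
From mathcomp Require Import complex.
From mathcomp Require Import all_classical all_reals all_analysis.

Set Implicit Arguments.
Unset Strict Implicit.
Unset Printing Implicit Defensive.

Import Order.TTheory GRing.Theory Num.Theory.
Import numFieldNormedType.Exports.

Local Open Scope ring_scope.
Local Open Scope complex_scope.

Section RealDifferentiation.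
Variables (R : realType) (T : finType).

(* The library has no normed space structure over R on T -> R[i], so real
   differentiability is taken in the coordinates
   ((Re f(t))_t, (Im f(t))_t) of f, an R-linear isomorphism of T -> R[i]
   with a pair of row vectors. *)
Definition coord_of_fun (f : T -> R[i]) : 'rV[R]_#|T| * 'rV[R]_#|T| :=
  (\row_k complex.Re (f (enum_val k)), \row_k complex.Im (f (enum_val k))).

Definition fun_of_coord (w : 'rV[R]_#|T| * 'rV[R]_#|T|) : T -> R[i] :=
  fun t => w.1 0 (enum_rank t) +i* w.2 0 (enum_rank t).

Lemma coord_of_funK : cancel coord_of_fun fun_of_coord.
Proof.
move=> f; apply/funext => t.
by rewrite /fun_of_coord /= !mxE enum_rankK; case: (f t).
Qed.

Lemma fun_of_coordK : cancel fun_of_coord coord_of_fun.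
Proof.
move=> [u v]; rewrite /coord_of_fun /fun_of_coord /=.
by congr pair; apply/rowP => k; rewrite mxE /= enum_valK.
Qed.

Definition critical_point (Phi : (T -> R[i]) -> R) (f : T -> R[i]) : Prop :=
  let F : 'rV[R]_#|T| * 'rV[R]_#|T| -> R := Phi \o fun_of_coord in
  differentiable F (coord_of_fun f) /\
  forall w, 'd F (coord_of_fun f) w = 0.

End RealDifferentiation.

Definition dot (K : pzRingType) (d : nat) (x y : 'rV[K]_d) : K :=
  \sum_(i < d) x 0 i * y 0 i.

Definition nontrivial_character (R : realType) (p : nat) (e : 'F_p -> R[i]) :
    Prop :=
  [/\ forall a, `|e a| = 1,
      forall a b, e (a + b) = e a * e b
    & exists a, e a <> 1].

Section Extension.
Variables (R : realType) (p d : nat) (e : 'F_p -> R[i]).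
Variable S : {set 'rV['F_p]_d}.

Definition extension (f : {xi | xi \in S} -> R[i]) (x : 'rV['F_p]_d) : R[i] :=
  (#|S|%:R)^-1 * \sum_(xi : {xi | xi \in S}) f xi * e (dot x (val xi)).

(* Normc.normc is the modulus as an element of R; the norm `|_| of R[i]
   takes its values in R[i]. *)
Definition L2_norm_sq (f : {xi | xi \in S} -> R[i]) : R :=
  (#|S|%:R)^-1 * \sum_(xi : {xi | xi \in S}) Normc.normc (f xi) ^+ 2.

Definition extension_functional (f : {xi | xi \in S} -> R[i]) : R :=
  (\sum_(x : 'rV['F_p]_d) Normc.normc (extension f x) ^+ 4)
    / L2_norm_sq f ^+ 2.

End Extension.

(* A point of F_p^4 is (xi, tau, sigma) with xi its first two coordinates. *)
Definition Gamma03 (p : nat) : {set 'rV['F_p]_(2 + 2)} :=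
  [set z | let xi := lsubmx z in
           let tau := rsubmx z 0 0 in
           let sigma := rsubmx z 0 1 in
           tau * sigma == dot xi xi].

Definition Upsilon03 (p : nat) : {set 'rV['F_p]_(2 + 2)} :=
  [set z | let xi := lsubmx z in
           let tau := rsubmx z 0 0 in
           let sigma := rsubmx z 0 1 in
           tau ^+ 2 + sigma ^+ 2 == dot xi xi].

(* Main.v *)
(* Write N(z) for the number of pairs (c, d) in S x S with c + d - z in S. The
   derivative of the functional at a constant c in the direction c * 1_{z}, made
   explicit by orthogonality of characters, shows that a constant is critical
   only if N is constant on S.

   After a linear change of variables S is the cone b a = u1^2 + k u2^2 in K^4,
   with k = 1 for Gamma and k = -1 for Upsilon. If N were constant on the cone,
   then summing N over the line of points (b, a, u) = (0, t, 0), which lies in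
   the cone, would give |K| N(0). Counting both sides, the contributions of the
   pairs with b = b' = 0 cancel and what remains is Z = |K|, where Z is the
   number of zeros of u1^2 + k u2^2. But Z = 1 + (|K| - 1) m, where m is the
   number of square roots of -k, and m is not 1 in odd characteristic. *)
Require Import Defs.
From HB Require Import structures.
From mathcomp Require Import all_boot all_order all_algebra.
From mathcomp Require Import complex.
From mathcomp Require Import all_classical all_reals all_analysis.
From mathcomp Require Import ring zify.

Set Implicit Arguments.
Unset Strict Implicit.
Unset Printing Implicit Defensive.

Import Order.TTheory GRing.Theory Num.Theory.
Import numFieldNormedType.Exports.

Local Open Scope ring_scope.
Local Open Scope complex_scope.

(* The library does not declare the join finZmodType on products. *)
HB.instance Definition _ (U V : finZmodType) := GRing.Zmodule.on (U * V)%type.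

(** This is the count N(z) of additive quadruples [c + d = z + w] in [A] with [z] held fixed; summed
    over [z] in [A] it is the additive energy of [A]. *)
Definition third_sum_count (V : finZmodType) (A : {set V}) (z : V) : nat :=
  (\sum_(c in A) \sum_(d in A) (c + d - z \in A)%R)%N.

(** * Additive quadruples on the cone *)

Section Cone.
Variables (K : finFieldType) (k : K).

Definition binary_form (u : K * K) : K := u.1 ^+ 2 + k * u.2 ^+ 2.

(* A point ((b, a), u) stands for (b, a, u1, u2). *)
Definition cone : {set K * K * (K * K)} :=
  [set v | v.1.1 * v.1.2 == binary_form v.2].

Local Notation q := binary_form.
Local Notation n := #|K|.
Local Notation Z := #|[set u | q u == 0]|.

Lemma sum_coneE (P : pred K) (F : K * K * (K * K) -> nat) :
  (\sum_(v in cone | P v.1.1) F v =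
    \sum_(b | P b) \sum_u \sum_a
      if (b, a, u) \in cone then F (b, a, u) else 0)%N.
Proof.
under [RHS]eq_bigr do rewrite exchange_big.
rewrite big_mkcond [RHS]big_mkcond /=.
transitivity (\sum_b \sum_a \sum_u
    if ((b, a, u) \in cone) && P b then F (b, a, u) else 0)%N.
  by rewrite pair_bigA pair_bigA; apply: eq_bigr => -[[b a] u].
apply: eq_bigr => b _; case: ifP => Pb.
  by under eq_bigr do under eq_bigr do rewrite andbT.
by under eq_bigr do under eq_bigr do rewrite andbF; rewrite !big1.
Qed.

(** Where b is nonzero, [b a = q u] determines a, so this part of the cone is a graph over (b,
    u). *)
Lemma sum_cone_graph (F : K * K * (K * K) -> nat) :
  (\sum_(v in cone | v.1.1 != 0%R) F v =
    \sum_(b | b != 0%R) \sum_u F (b, q u / b, u)%R)%N.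
Proof.
rewrite (sum_coneE (fun b => b != 0)).
apply: eq_bigr => b b0; apply: eq_bigr => u _.
rewrite (bigD1 (q u / b)) //= big1 ?addn0 => [|a aq].
  by rewrite inE /= mulrCA divff // mulr1 eqxx.
rewrite inE /=; case: eqP => // eq_q; case/eqP: aq.
by rewrite -eq_q mulrAC divff // mul1r.
Qed.

(** Where b = 0, the equation reduces to [q u = 0] and leaves a free. *)
Lemma sum_cone_vertical (F : K * K * (K * K) -> nat) :
  (\sum_(v in cone | v.1.1 == 0%R) F v =
    \sum_(u | q u == 0%R) \sum_a F (0%R, a, u))%N.
Proof.
rewrite (sum_coneE (fun b => b == 0)) big_pred1_eq [RHS]big_mkcond /=.
apply: eq_bigr => u _.
under eq_bigr do rewrite inE /= mul0r eq_sym.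
by case: ifP => // _; rewrite big1.
Qed.

Lemma card_affine_root (x y : K) :
  (\sum_t (x == t * y)%R = if y != 0%R then 1 else n * (x == 0%R))%N.
Proof.
case: (eqVneq y 0) => [->|y0] /=.
  by under eq_bigr do rewrite mulr0; rewrite sum_nat_const.
rewrite (bigD1 (x / y)) //= divfK // eqxx big1 // => t tx.
by case: eqP => // xt; case/eqP: tx; rewrite xt mulfK.
Qed.

(** The shift only changes a, so the cone equation is affine in [t], with slope b. Hence a shift by
    a random point of the line can be counted exactly. *)
Lemma mem_cone_shift (v : K * K * (K * K)) t :
  (v - ((0, t), 0) \in cone) = (v.1.1 * v.1.2 - q v.2 == t * v.1.1).
Proof.
by rewrite inE /= !subr0 -subr_eq0 -[RHS]subr_eq0; congr (_ == 0); ring.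
Qed.

Lemma sum_shift (v : K * K * (K * K)) :
  (\sum_t (v - ((0, t), 0) \in cone)%R =
    if v.1.1 != 0%R then 1 else n * (v \in cone))%N.
Proof.
under eq_bigr do rewrite mem_cone_shift.
by rewrite card_affine_root subr_eq0 inE.
Qed.

(** The defect (b + b')(q u / b + q u' / b') - q(u + u') equals q(b' u - b u') / (b b'). *)
Lemma mem_cone_add (b b' : K) (u u' : K * K) : b != 0 -> b' != 0 ->
  ((b, q u / b, u) + (b', q u' / b', u') \in cone) =
  (q (b' * u.1 - b * u'.1, b' * u.2 - b * u'.2) == 0).
Proof.
move=> b0 b'0; rewrite inE /= -subr_eq0.
rewrite -(inj_eq (mulfI (mulf_neq0 b0 b'0))) mulr0; congr (_ == 0).
by rewrite /q /=; field; rewrite b0 b'0.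
Qed.

Lemma sum_pairs_cone (H : K * K * (K * K) -> K * K * (K * K) -> nat) :
  (forall c d, H c d = H d c) ->
  (\sum_(c in cone) \sum_(d in cone) H c d =
    \sum_(c in cone | c.1.1 != 0%R) \sum_(d in cone | d.1.1 != 0%R) H c d +
    2 * (\sum_(c in cone | c.1.1 != 0%R) \sum_(d in cone | d.1.1 == 0%R) H c d) +
    \sum_(c in cone | c.1.1 == 0%R) \sum_(d in cone | d.1.1 == 0%R) H c d)%N.
Proof.
move=> symH.
have splitH c : (\sum_(d in cone) H c d =
    \sum_(d in cone | d.1.1 != 0%R) H c d +
    \sum_(d in cone | d.1.1 == 0%R) H c d)%N.
  rewrite (bigID (fun d => d.1.1 != 0)) /=; congr addn.
  by apply: eq_bigl => d; rewrite negbK.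
under eq_bigr do rewrite splitH.
rewrite (bigID (fun c => c.1.1 != 0)) /= !big_split /=.
under [X in (_ + (X + _))%N]eq_bigl do rewrite negbK.
under [X in (_ + (_ + X))%N]eq_bigl do rewrite negbK.
rewrite [X in (_ + (X + _))%N]exchange_big /=.
under [X in (_ + (X + _))%N]eq_bigr do under eq_bigr do rewrite symH.
by rewrite mul2n -addnn !addnA.
Qed.

Lemma card_nonzero (b0 : K) : #|[pred b | b != b0]| = n.-1.
Proof. exact: cardC1. Qed.

Lemma mem_cone_add_vertical (b a : K) (u u' : K * K) : b != 0 ->
  ((b, q u / b, u) + (0, a, u') \in cone) = (q (u + u') - q u == a * b).
Proof.
move=> b0; rewrite inE /= addr0 -subr_eq0 -[RHS]subr_eq0 -oppr_eq0.
by congr (_ == 0); field.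
Qed.

(** For each b nonzero, each u and each zero u' of [q], exactly one a puts the sum on the cone. *)
Lemma sum_mem_cone_mixed : (\sum_(c in cone | c.1.1 != 0%R)
  \sum_(d in cone | d.1.1 == 0%R) (c + d \in cone)%R = n.-1 * (n ^ 2 * Z))%N.
Proof.
rewrite sum_cone_graph -(card_nonzero 0) -sum_nat_const.
apply: eq_bigr => b b0.
rewrite -mulnn -card_prod -sum_nat_const; apply: eq_bigr => u _.
rewrite sum_cone_vertical -sum1_card.
apply: eq_big => [u'|u' _]; first by rewrite inE.
under eq_bigr do rewrite mem_cone_add_vertical //.
by rewrite card_affine_root b0.
Qed.

(** For fixed u', the map u -> b' u - b u' is a bijection of the plane, so each u' contributes the
    number of zeros of [q]. *)
Lemma sum_mem_cone_graph (b b' : K) : b != 0 -> b' != 0 ->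
  (\sum_u \sum_u' ((b, q u / b, u) + (b', q u' / b', u') \in cone)%R = n ^ 2 * Z)%N.
Proof.
move=> b0 b'0; rewrite exchange_big -mulnn -card_prod -sum_nat_const.
apply: eq_bigr => u' _.
pose f u := (b' * u.1 - b * u'.1, b' * u.2 - b * u'.2).
have bij_f : bijective f.
  by exists (fun w => ((w.1 + b * u'.1) / b', (w.2 + b * u'.2) / b'))
    => [] [x y]; rewrite /f /=; congr pair; field.
transitivity (\sum_w (q w == 0%R))%N.
  rewrite [RHS](reindex f) /=; last exact: onW_bij.
  by apply: eq_bigr => u _; rewrite mem_cone_add.
by rewrite -big_mkcond sum1_card; apply: eq_card => u; rewrite !inE.
Qed.

(** The sum over pairs with b = b' = 0 is left unevaluated: it reappears, times |K|, in the sum over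
    the line and cancels there. *)
Lemma third_sum_count_cone0 : third_sum_count cone 0 =
  (n.-1 * (n.-1 * (n ^ 2 * Z)) + 2 * (n.-1 * (n ^ 2 * Z)) +
   \sum_(c in cone | c.1.1 == 0%R) \sum_(d in cone | d.1.1 == 0%R)
     (c + d \in cone)%R)%N.
Proof.
rewrite /third_sum_count.
under eq_bigr do under eq_bigr do rewrite subr0.
rewrite sum_pairs_cone => [|c d]; last by rewrite addrC.
rewrite sum_mem_cone_mixed; congr (_ + _ + _)%N.
rewrite sum_cone_graph.
under eq_bigr do under eq_bigr do rewrite sum_cone_graph.
rewrite -{1}(card_nonzero 0) -sum_nat_const; apply: eq_bigr => b b0.
rewrite exchange_big -(card_nonzero 0) -sum_nat_const.
by apply: eq_bigr => b' b'0; rewrite sum_mem_cone_graph.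
Qed.

(** Summing over t first, a pair with b + b' nonzero counts once, and a pair with b + b' = 0 counts
    |K| times if its sum lies on the cone, and otherwise not at all. *)
Lemma sum_third_sum_count_cone :
  (\sum_t third_sum_count cone ((0, t), 0)%R =
  n.-1 * (n.-2 * n ^ 4 + n * (n ^ 2 * Z)) + 2 * (n.-1 * (n ^ 2 * (n * Z))) +
   n * \sum_(c in cone | c.1.1 == 0%R) \sum_(d in cone | d.1.1 == 0%R)
     (c + d \in cone)%R)%N.
Proof.
rewrite /third_sum_count exchange_big.
under eq_bigr => c _.
  rewrite exchange_big.
  under eq_bigr do rewrite sum_shift.
  over.
rewrite /= sum_pairs_cone => [|c d]; last by rewrite addrC [d + c]addrC.
congr (_ + _ + _)%N.
- rewrite sum_cone_graph.
  under eq_bigr do under eq_bigr do rewrite sum_cone_graph.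
  rewrite -{1}(card_nonzero 0) -sum_nat_const; apply: eq_bigr => b b0.
  (* Among the nonzero b', only b' = -b makes b + b' vanish; the other |K| - 2 values give one for
     each pair (u, u'). *)
  rewrite exchange_big (bigD1 (- b)) ?oppr_eq0 //= addnC; congr addn.
    have -> : n.-2 = #|[pred b' | (b' != 0) && (b' != - b)]|.
      rewrite -(card_nonzero 0) (cardD1 (- b)) inE /= oppr_eq0 b0 /=.
      by apply: eq_card => x; rewrite !inE andbC.
    rewrite -sum_nat_const; apply: eq_bigr => b' /andP[b'0 b'b].
    rewrite addrC -[b](opprK) subr_eq0 b'b.
    rewrite !sum_nat_const !card_prod muln1.
    by rewrite !expnS expn0; ring.
  rewrite subrr eqxx /=; under eq_bigr do rewrite -big_distrr.
  by rewrite -big_distrr sum_mem_cone_graph ?oppr_eq0.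
- congr muln; rewrite sum_cone_graph -(card_nonzero 0) -sum_nat_const.
  apply: eq_bigr => b b0; rewrite -mulnn -card_prod -sum_nat_const.
  apply: eq_bigr => u _; rewrite sum_cone_vertical [in RHS]mulnC -sum_nat_const.
  apply: eq_big => [u'|u' _]; first by rewrite inE.
  by under eq_bigr do rewrite addr0 b0; rewrite sum1_card.
- rewrite big_distrr; apply: eq_bigr => c /andP[_ /eqP c0].
  rewrite big_distrr; apply: eq_bigr => d /andP[_ /eqP d0].
  by rewrite /= c0 d0 addr0 eqxx.
Qed.

(** The row y = 0 contains only the origin. For y nonzero, the substitution x = w y turns the
    equation into w^2 = -k. *)
Lemma card_binary_form_zero :
  (Z = 1 + n.-1 * #|[set w | w ^+ 2 == - k]|)%N.
Proof.
rewrite -sum1_card big_mkcond /=.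
transitivity (\sum_y \sum_x (x ^+ 2 + k * y ^+ 2 == 0)%R)%N.
  rewrite exchange_big pair_bigA; apply: eq_bigr => -[x y] _.
  by rewrite inE /q /=; case: eqP.
rewrite (bigD1 0) //=; congr addn.
  rewrite (bigD1 0) //= expr0n mulr0 addr0 eqxx big1 // => x x0.
  by rewrite addr0 expf_eq0 /= (negbTE x0).
rewrite -(card_nonzero 0) -sum_nat_const; apply: eq_bigr => y y0.
have bij : bijective (fun w => w * y) by exists (fun x => x / y) => x; field.
rewrite (reindex _ (onW_bij _ bij)) -sum1_card [RHS]big_mkcond /=.
apply: eq_bigr => w _; rewrite inE.
have -> : (w * y) ^+ 2 + k * y ^+ 2 = (w ^+ 2 + k) * y ^+ 2 by ring.
by rewrite mulf_eq0 expf_eq0 (negbTE y0) orbF addr_eq0; case: eqP.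
Qed.

(** The roots are stable under negation, so a single root w would satisfy 2 w = 0, forcing x = 0. *)
Lemma card_sqr_eq_neq1 (x : K) : 2%:R != 0 :> K -> x != 0 ->
  #|[set w | w ^+ 2 == x]| != 1%N.
Proof.
move=> two0 x0; apply/negP => /cards1P[w eqw].
have : - w \in [set w | w ^+ 2 == x].
  by have: w \in [set w | w ^+ 2 == x];
    [rewrite eqw set11 | rewrite !inE sqrrN].
have /eqP w2 : w ^+ 2 == x by have := set11 w; rewrite -eqw inE.
rewrite eqw inE eq_sym -subr_eq0 opprK -mulr2n -mulr_natr mulf_eq0.
rewrite (negbTE two0) orbF => /eqP w0.
by move: x0; rewrite -w2 w0 expr0n eqxx.
Qed.

Lemma third_sum_count_cone_not_constant (C : nat) :
  k != 0 -> (2 < n)%N -> 2%:R != 0 :> K ->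
  ~ forall z, z \in cone -> third_sum_count cone z = C.
Proof.
move=> k0 n2 two0 constC.
have q00 : q 0 = 0 by rewrite /q /=; ring.
have T : (\sum_t third_sum_count cone ((0, t), 0)%R =
    n * third_sum_count cone 0%R)%N.
  rewrite -sum_nat_const; apply: eq_bigr => t _.
  by rewrite !constC // inE /= !mul0r q00.
have : Z != n.
  apply: contra (@card_sqr_eq_neq1 (- k) two0 _); last by rewrite oppr_eq0.
  rewrite card_binary_form_zero => /eqP eqn.
  suff : (n.-1 * #|[set w | w ^+ 2 == - k]| == n.-1 * 1)%N.
    by rewrite eqn_mul2l => /orP[/eqP|//]; lia.
  by apply/eqP; lia.
case/eqP; move: T; rewrite sum_third_sum_count_cone third_sum_count_cone0.
move: Z (\sum_(c in cone | _) _)%N => z X; case: (#|K|) n2 => [//|[//|m]] m0 /=.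
move=> eqT.
(* With |K| = m + 2, the mixed and the vertical terms cancel. What remains is z = |K| times the
   common factor (|K| - 1) |K|^3 (|K| - 2), positive since |K| > 2. *)
have {}eqT : ((m.+1 * m.+2 ^ 3 * m) * z = (m.+1 * m.+2 ^ 3 * m) * m.+2)%N.
  by move: eqT; rewrite !expnS !expn0; lia.
by apply/eqP; rewrite -(@eqn_pmul2l (m.+1 * m.+2 ^ 3 * m)) ?eqT ?muln_gt0 ?expn_gt0.
Qed.

End Cone.

(** * Derivatives along real lines *)

Lemma derive_quotient_eq0 (R : realType) (K : R) (P Q : {poly R}) :
  K != 0 -> Q.[0] != 0 ->
  'D_1 (fun s => K * (P.[s] / Q.[s])) (0 : R) = 0 ->
  P^`().[0] * Q.[0] = P.[0] * Q^`().[0].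
Proof.
move=> K0 Q0.
have dP := is_derive_poly P 0; have dQ := is_derive_poly Q 0.
have dV : is_derive (0 : R) 1 (fun s => Q.[s]^-1) (- Q.[0] ^- 2 * Q^`().[0]).
  apply: DeriveDef; first exact: derivableV.
  by rewrite deriveV // derive_val.
have [_ dval] := is_deriveZ K (is_deriveM dP dV).
move=> /(etrans (esym dval)) /eqP.
rewrite mulf_eq0 (negbTE K0) /= => /eqP.
rewrite /GRing.scale /= => eq0; apply/eqP; rewrite -subr_eq0.
(* Multiplying the quotient rule by Q(0)^2 clears the denominators. *)
apply/eqP/(etrans _ (etrans (congr1 ( *%R (Q.[0] ^+ 2)) eq0) (mulr0 _))).
by field.
Qed.

Section CriticalPoint.
Variables (R : realType) (T : finType).

Lemma fun_of_coordD (f g : T -> R[i]) (s : R) :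
  fun_of_coord (s *: coord_of_fun g + coord_of_fun f) =
  (fun t => f t + s%:C * g t).
Proof.
apply/funext => t; rewrite /fun_of_coord /= !mxE !enum_rankK.
case: (f t) (g t) => [a b] [c d] /=; simpc.
by rewrite [a + _]addrC [b + _]addrC.
Qed.

Lemma critical_point_derive (Phi : (T -> R[i]) -> R) (f g : T -> R[i]) :
  critical_point Phi f ->
  'D_1 (fun s : R => Phi (fun t => f t + s%:C * g t)) (0 : R) = 0.
Proof.
case=> diff_f /(_ (coord_of_fun g)).
rewrite -deriveE // => /(etrans _); apply; rewrite /derive.
(* Both derivatives are limits of difference quotients, so it suffices to match the quotients at
   each [h]. *)
apply: (congr1 (fun k : R -> R => lim (k @ 0^')%classic)).
apply/funext => h /=; rewrite -!fun_of_coordD; congr (_ *: (Phi _ - Phi _)).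
  by congr fun_of_coord; rewrite /GRing.scale /= mulr1 addr0.
by rewrite scale0r add0r.
Qed.

End CriticalPoint.

Lemma normc_sqr (R : rcfType) (z : R[i]) :
  Normc.normc z ^+ 2 = complex.Re z ^+ 2 + complex.Im z ^+ 2.
Proof. by case: z => a b /=; rewrite sqr_sqrtr ?addr_ge0 ?sqr_ge0. Qed.

Lemma normc_sqrD (R : rcfType) (z w : R[i]) (s : R) :
  Normc.normc (z + s%:C * w) ^+ 2 = Normc.normc z ^+ 2 +
    2 * complex.Re (z * w^*%C) * s + Normc.normc w ^+ 2 * s ^+ 2.
Proof.
by rewrite !normc_sqr; case: z w => [a b] [c d] /=; ring.
Qed.

(** * Additive characters and their orthogonality *)

Section Character.
Variables (R : realType) (p : nat) (e : 'F_p -> R[i]).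
Hypothesis char_e : nontrivial_character e.

Lemma character_neq0 a : e a != 0.
Proof. by case: char_e => /(_ a) e1 _ _; rewrite -normr_eq0 e1 oner_eq0. Qed.

Lemma character0 : e 0 = 1.
Proof.
case: char_e => _ eD _; apply: (mulfI (character_neq0 0)).
by rewrite -eD addr0 mulr1.
Qed.

Lemma character_conj a : (e a)^*%C = e (- a).
Proof.
case: char_e => /(_ a) e1 eD _; apply: (mulfI (character_neq0 a)).
by rewrite -sqr_normc e1 expr1n -eD subrr character0.
Qed.

Lemma normc_character a : Normc.normc (e a) = 1.
Proof.
by case: char_e => /(_ a) e1 _ _; case: e1.
Qed.

Lemma dotDl d (x y z : 'rV['F_p]_d) : dot (x + y) z = dot x z + dot y z.
Proof.
by rewrite -big_split; apply: eq_bigr => i _; rewrite mxE mulrDl.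
Qed.

Lemma dotDr d (x y z : 'rV['F_p]_d) : dot x (y + z) = dot x y + dot x z.
Proof.
by rewrite -big_split; apply: eq_bigr => i _; rewrite mxE mulrDr.
Qed.

Lemma dotNr d (x y : 'rV['F_p]_d) : dot x (- y) = - dot x y.
Proof.
by rewrite -sumrN; apply: eq_bigr => i _; rewrite mxE mulrN.
Qed.

Lemma sum_character d (v : 'rV['F_p]_d) :
  \sum_x e (dot x v) = (#|{: 'rV['F_p]_d}| * (v == 0))%:R.
Proof.
case: eqP => [->|v0].
  rewrite muln1 -sum1_card natr_sum; apply: eq_bigr => x _.
  by rewrite /dot big1 ?character0 // => i _; rewrite mxE mulr0.
rewrite muln0; case: char_e => _ eD [a ea].
have [i vi] : exists i, v 0 i != 0.
  apply/existsP; apply: contra_notT v0 => /existsPn v0.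
  by apply/rowP => i; rewrite mxE; apply/eqP; rewrite -[_ == _]negbK v0.
(* Translating the sum by [x0] multiplies it by [e a], which is not 1, so the sum vanishes. *)
pose x0 := a / v 0 i *: delta_mx 0 i : 'rV['F_p]_d.
have dot0 : dot x0 v = a.
  rewrite /dot (bigD1 i) //= big1 => [|j ji].
    by rewrite !mxE !eqxx mulr1 divfK // addr0.
  by rewrite !mxE (negbTE ji) andbF mulr0 mul0r.
apply/eqP; move: ea => /eqP; rewrite -subr_eq0 => ea.
rewrite -(mulrI_eq0 _ (mulfI ea)) mulrBl mul1r subr_eq0; apply/eqP.
rewrite big_distrr [RHS](reindex (+%R x0)) /=; last first.
  by apply: onW_bij; exists (+%R (- x0)) => x; rewrite ?addKr ?addNKr.
by apply: eq_bigr => x _; rewrite dotDl dot0 eD.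
Qed.

End Character.

Lemma horner_deriv_sqr (R : comNzRingType) (a b : R) :
  ((a%:P + b%:P * 'X + 'X ^+ 2) ^+ 2)^`().[0] = 2 * (a * b).
Proof.
rewrite !expr2 !(derivM, derivD, derivC, derivX) !hornerE /=; ring.
Qed.

(** * The extension functional near a constant *)

Section Extension.
Variables (R : realType) (p d : nat) (e : 'F_p -> R[i]).
Variable S : {set 'rV['F_p]_d}.
Hypothesis char_e : nontrivial_character e.
Implicit Types (c : R[i]) (eta x : 'rV['F_p]_d) (s : R).

Let exp_sum x : R[i] := \sum_(xi in S) e (dot x xi).
Let A x : R := Normc.normc (exp_sum x) ^+ 2.
Let B eta x : R := complex.Re (exp_sum x * (e (dot x eta))^*%C).
Let perturb c eta s : {xi | xi \in S} -> R[i] :=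
  fun t => c + s%:C * (if val t == eta then c else 0).

Lemma extension_perturb c eta s x : eta \in S ->
  extension e (perturb c eta s) x =
  #|S|%:R^-1 * c * (exp_sum x + s%:C * e (dot x eta)).
Proof.
move=> etaS; rewrite /extension /perturb -mulrA; congr (_ * _).
rewrite -(big_sub S (fun xi => (c + s%:C * (if xi == eta then c else 0)) *
  e (dot x xi))).
under eq_bigr do rewrite mulrDl.
rewrite big_split -big_distrr /= mulrDr; congr (_ + _).
rewrite (bigD1 eta) //= eqxx big1 ?addr0 => [|xi /andP[_ /negbTE->]]; last by ring.
by ring.
Qed.

Lemma L2_norm_sq_perturb c eta s : eta \in S ->
  L2_norm_sq (perturb c eta s) =
  #|S|%:R^-1 * Normc.normc c ^+ 2 * (#|S|%:R + 2 * s + s ^+ 2).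
Proof.
move=> etaS; rewrite /L2_norm_sq /perturb -mulrA; congr (_ * _).
rewrite -(big_sub S (fun xi => Normc.normc
  (c + s%:C * (if xi == eta then c else 0)) ^+ 2)).
have normD xi : Normc.normc (c + s%:C * (if xi == eta then c else 0)) ^+ 2 =
    Normc.normc c ^+ 2 + (if xi == eta then Normc.normc c ^+ 2 * (2 * s + s ^+ 2) else 0).
  case: eqP => _; last by rewrite mulr0 !addr0.
  by rewrite normc_sqrD normc_sqr; case: (c) => a b /=; ring.
under eq_bigr do rewrite normD.
rewrite big_split /= sumr_const (bigD1 eta) //= eqxx big1 => [|xi /andP[_ /negbTE->]] //.
by rewrite -mulr_natr; ring.
Qed.

(** Up to constant factors, [P] and [Q] are the numerator and denominator of the functional along
    the perturbation: |z + s w|^2 is quadratic in real s, with leading coefficient 1 when |w| =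
    1. *)
Let P eta : {poly R} :=
  \sum_x ((A x)%:P + (2 * B eta x)%:P * 'X + 'X ^+ 2) ^+ 2.
Let Q : {poly R} := (#|S|%:R%:P + 2%:P * 'X + 'X ^+ 2) ^+ 2.

Lemma extension_functional_perturb c eta s : eta \in S ->
  extension_functional e (perturb c eta s) =
  (Normc.normc (#|S|%:R^-1 * c) ^+ 4 / (#|S|%:R^-1 * Normc.normc c ^+ 2) ^+ 2) *
  ((P eta).[s] / Q.[s]).
Proof.
move=> etaS; rewrite /extension_functional L2_norm_sq_perturb //.
rewrite [in RHS]mulrACA -invfM; congr (_ / _); last first.
  rewrite /Q horner_exp -exprMn; congr ((_ * _) ^+ 2).
  by rewrite !hornerE.
rewrite horner_sum mulr_sumr; apply: eq_bigr => x _.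
rewrite extension_perturb // Normc.normcM exprMn; congr (_ * _).
by rewrite !hornerE /= (exprM _ 2 2) normc_sqrD normc_character // expr1n mul1r.
Qed.

(** The product expands into characters at a + b - eta - c with a, b, c in [S]; summing over x keeps
    only c = a + b - eta. *)
Lemma sum_normc_sqr_Re eta :
  \sum_x A x * B eta x = (#|{: 'rV['F_p]_d}| * third_sum_count S eta)%:R.
Proof.
have expand x : exp_sum x * (exp_sum x)^*%C * (exp_sum x * (e (dot x eta))^*%C) =
    \sum_(a in S) \sum_(b in S) \sum_(c in S) e (dot x (a + b - eta - c)).
  have -> : (exp_sum x)^*%C = \sum_(c in S) e (- dot x c).
    by rewrite raddf_sum; apply: eq_bigr => c _; rewrite -(character_conj char_e).
  rewrite character_conj // -mulrA mulr_suml; apply: eq_bigr => a _.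
  rewrite mulrA mulrC !mulr_suml; apply: eq_bigr => b _.
  rewrite mulrA mulr_sumr; apply: eq_bigr => c _.
  by case: char_e => _ eD _; rewrite !dotDr !dotNr !eD; ring.
have A_mul x w : A x * complex.Re w = complex.Re (exp_sum x * (exp_sum x)^*%C * w).
  rewrite /A normc_sqr; case: (exp_sum x) w => [a b] [a' b'] /=; ring.
under eq_bigr do rewrite A_mul expand.
have ReE : complex.Re ((#|{: 'rV['F_p]_d}| * third_sum_count S eta)%:R : R[i]) =
    (#|{: 'rV['F_p]_d}| * third_sum_count S eta)%:R.
  by rewrite -(rmorph_nat (real_complex R)).
rewrite -[LHS](raddf_sum (@complex.Re R)) -[RHS]ReE; congr complex.Re.
rewrite exchange_big /third_sum_count big_distrr natr_sum; apply: eq_bigr => a _.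
rewrite exchange_big big_distrr natr_sum; apply: eq_bigr => b _.
rewrite exchange_big /=; under eq_bigr do rewrite sum_character //.
rewrite -natr_sum -big_distrr; congr ((_ * _)%:R) => /=.
under eq_bigr do rewrite subr_eq0 eq_sym.
rewrite -big_mkcondr /=; case: (boolP (_ \in S)) => [abS|/negP abS].
  rewrite (big_pred1 (a + b - eta)) // => c /=.
  by case: eqP => [->|]; rewrite ?abS ?andbF.
by rewrite big_pred0 // => c; apply/negP => /andP[cS /eqP ceq]; rewrite -ceq in abS.
Qed.

(** Criticality in the direction c 1_{eta} evaluates the sum of [A x * B eta x] as an expression
    free of eta; by orthogonality that sum is a fixed multiple of N(eta). *)
Lemma critical_point_third_sum_count c : c != 0 ->
  critical_point (extension_functional e (S := S)) (fun _ => c) ->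
  exists C, forall eta, eta \in S -> third_sum_count S eta = C.
Proof.
move=> c0 crit; have [->|[eta0 eta0S]] := set_0Vmem S.
  by exists 0%N => eta; rewrite inE.
exists (third_sum_count S eta0).
have N0 : (#|S|%:R : R) != 0 by rewrite pnatr_eq0 -lt0n (cardD1 eta0) eta0S.
have main eta : eta \in S -> \sum_x A x * B eta x = (\sum_x A x ^+ 2) / #|S|%:R.
  move=> etaS; have := critical_point_derive
    (fun t : {xi | xi \in S} => if val t == eta then c else 0) crit.
  under eq_fun do rewrite extension_functional_perturb //.
  have normc_neq0 z : z != 0 -> Normc.normc (z : R[i]) != 0.
    by apply: contra => /eqP /Normc.eq0_normc ->.
  move=> /derive_quotient_eq0 eqPQ.
  have K0 : Normc.normc (#|S|%:R^-1 * c) ^+ 4 /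
      (#|S|%:R^-1 * Normc.normc c ^+ 2) ^+ 2 != 0.
    have N0' : (#|S|%:R : R[i]) != 0 by rewrite pnatr_eq0 -lt0n (cardD1 eta0) eta0S.
    by rewrite !(mulf_neq0, expf_neq0, invr_neq0, normc_neq0).
  have dQ : Q^`().[0] = 4 * #|S|%:R.
    rewrite horner_deriv_sqr; ring.
  have dP : (P eta)^`().[0] = 4 * \sum_x A x * B eta x.
    rewrite /P raddf_sum horner_sum mulr_sumr; apply: eq_bigr => x _.
    by rewrite horner_deriv_sqr; ring.
  have P0 : (P eta).[0] = \sum_x A x ^+ 2.
    by rewrite horner_sum; apply: eq_bigr => x _; rewrite !hornerE /=; ring.
  have Q0 : Q.[0] = #|S|%:R ^+ 2 by rewrite /Q !hornerE /=; ring.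
  have {eqPQ} := eqPQ K0; rewrite dP P0 Q0 dQ => /(_ (expf_neq0 _ N0)) eqAB.
  apply: (mulfI (expf_neq0 2 N0)).
  apply: (@mulfI _ 4); first by rewrite pnatr_eq0.
  transitivity (4 * (\sum_x A x * B eta x) * #|S|%:R ^+ 2); first by ring.
  by rewrite eqAB; field.
move=> eta etaS; have := etrans (main _ etaS) (esym (main _ eta0S)).
rewrite !sum_normc_sqr_Re => /eqP.
rewrite eqr_nat eqn_mul2l => /orP[|/eqP//].
by rewrite (cardD1 0).
Qed.

End Extension.

(** * Transfer from the cone to the two quadrics *)

Lemma third_sum_count_bij (U V : finZmodType) (f : U -> V) (A : {set U})
    (B : {set V}) z :
  zmod_morphism f -> bijective f -> (forall x, (f x \in B) = (x \in A)) ->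
  third_sum_count B (f z) = third_sum_count A z.
Proof.
move=> fB bij_f fAB; rewrite /third_sum_count (reindex f) /=; last exact: onW_bij.
apply: eq_big => [x|x _]; first exact: fAB.
rewrite (reindex f) /=; last exact: onW_bij.
apply: eq_big => [y|y _]; first exact: fAB.
have f0 : f 0 = 0 by rewrite -(subrr 0) fB subrr.
have fN : f (- y) = - f y by rewrite -[in LHS]sub0r fB f0 sub0r.
have fD : f (x + y) = f x + f y by rewrite -[in LHS](opprK y) fB fN opprK.
by rewrite -fD -fB fAB.
Qed.

Lemma third_sum_count_quadric_not_constant (K : finFieldType) (k : K)
    (f : 'rV[K]_(2 + 2) -> K * K * (K * K)) (S : {set 'rV[K]_(2 + 2)}) (C : nat) :
  k != 0 -> (2 < #|K|)%N -> 2%:R != 0 :> K ->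
  zmod_morphism f -> injective f -> (forall x, (f x \in cone k) = (x \in S)) ->
  ~ forall z, z \in S -> third_sum_count S z = C.
Proof.
move=> k0 K2 two0 fB inj_f fS constC.
have bij_f : bijective f.
  (* Both sides have |K|^4 elements, so injectivity suffices. *)
  by apply: inj_card_bij => //; rewrite card_mx !card_prod mul1n !expnS expn0; lia.
apply: (third_sum_count_cone_not_constant (C := C) k0 K2 two0) => v.
have [g _ gK] := bij_f; rewrite -(gK v) fS => gS.
by rewrite (third_sum_count_bij _ fB bij_f fS) constC.
Qed.

Lemma row4P (K : nzRingType) (z w : 'rV[K]_(2 + 2)) :
  [/\ lsubmx z 0 0 = lsubmx w 0 0, lsubmx z 0 1 = lsubmx w 0 1,
      rsubmx z 0 0 = rsubmx w 0 0 & rsubmx z 0 1 = rsubmx w 0 1] -> z = w.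
Proof.
case=> z0 z1 z2 z3; rewrite -[z]hsubmxK -[w]hsubmxK; congr row_mx;
  apply/rowP => -[[|[|i]] lt_i] //.
- by rewrite (_ : Ordinal lt_i = 0) //; apply: val_inj.
- by rewrite (_ : Ordinal lt_i = 1) //; apply: val_inj.
- by rewrite (_ : Ordinal lt_i = 0) //; apply: val_inj.
- by rewrite (_ : Ordinal lt_i = 1) //; apply: val_inj.
Qed.

Theorem theorem1p6 (R : realType) (p : nat) (e : 'F_p -> R[i])
    (S : {set 'rV['F_p]_(2 + 2)}) (c : R[i]) :
  prime p -> odd p -> nontrivial_character e ->
  S = Gamma03 p \/ S = Upsilon03 p ->
  c != 0 ->
  ~ critical_point (@extension_functional R p (2 + 2) e S) (fun _ => c).
Proof.
move=> p_pr p_odd char_e S_def c0 /(critical_point_third_sum_count char_e c0)[C].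
have p2 : (2 < p)%N by case: p p_pr p_odd {e S c char_e S_def c0 C} => [|[|[|]]].
have K2 : (2 < #|'F_p|)%N by rewrite card_Fp.
have two0 : 2%:R != 0 :> 'F_p.
  by rewrite -(dvdn_pcharf (pchar_Fp p_pr)) gtnNdvd.
have dotE (xi : 'rV['F_p]_2) : dot xi xi = xi 0 0 ^+ 2 + xi 0 1 ^+ 2.
  rewrite /dot big_ord_recl big_ord1 !expr2.
  by rewrite (_ : lift ord0 ord0 = 1) //; apply: val_inj.
case: S_def => ->.
(* Here (b, a, u) = (tau, sigma, xi), a mere reordering of coordinates. *)
- apply: (@third_sum_count_quadric_not_constant _ 1
    (fun z => ((rsubmx z 0 0, rsubmx z 0 1), (lsubmx z 0 0, lsubmx z 0 1)))) => //.
  + by move=> x y; rewrite !mxE.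
  + by move=> z w [z2 z3 z0 z1]; apply: row4P.
  + by move=> z; rewrite !inE /binary_form /= dotE mul1r.
(* The equation factors as (tau + xi_1)(tau - xi_1) = xi_2^2 - sigma^2, which gives b, a and u =
   (xi_2, sigma). *)
- apply: (@third_sum_count_quadric_not_constant _ (-1)
    (fun z => ((rsubmx z 0 0 + lsubmx z 0 0, rsubmx z 0 0 - lsubmx z 0 0),
               (lsubmx z 0 1, rsubmx z 0 1)))) => //.
  + by rewrite oppr_eq0 oner_neq0.
  + move=> x y; rewrite !mxE; congr (_, _, (_, _)).
    * by apply: etrans (addrACA _ _ _ _) _; rewrite -opprD.
    * by apply: etrans (congr1 _ (opprD _ _)) _; rewrite addrACA -opprD.
  + move=> z w /eqP; rewrite !xpair_eqE.
    move=> /andP[/andP[/eqP zD /eqP zB] /andP[/eqP z1 /eqP z3]].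
    (* b + a = 2 tau recovers tau because 2 is invertible. *)
    have z2 : rsubmx z 0 0 = rsubmx w 0 0.
      apply: (mulfI two0).
      rewrite (_ : 2 * _ = rsubmx z 0 0 + lsubmx z 0 0 +
        (rsubmx z 0 0 - lsubmx z 0 0)); last by ring.
      by rewrite zD zB; ring.
    by apply: row4P; split=> //; move: zD; rewrite z2 => /addrI.
  + move=> z; rewrite !inE /binary_form /= dotE -subr_eq0 -[RHS]subr_eq0.
    by congr (_ == 0); ring.
Qed.
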